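(* Let $n\ge 3$ be odd and let $D$ be the directed graph on $[n+1]$ with arc set $\{1v: v\ne 1\}\cup\{vv: v\ne 1\}$. Then $\mathrm{crank}[D]=2^n$, $\mathrm{minrank}[D,2]=2^{\lceil n/2\rceil}+2^{\lfloor n/2\rfloor}-1$, and $\mathrm{minrank}[D,n]=\mathrm{minrank}[D]=n+1$.
   Context: For $q\ge2$, $\langle q\rangle=\{0,\dots,q-1\}$. For $f:\langle q\rangle^{N}\to\langle q\rangle^{N}$ (here $N=n+1$), $\mathrm{IG}(f)$ is the graph on $[N]$ with an arc $uv$ iff there exist $a,b$ differing only in coordinate $u$ with $f_v(a)\ne f_v(b)$; $F[D,q]=\{f:\mathrm{IG}(f)=D\}$; $\operatorname{rank}(f)$ is the number of images of $f$; $\mathrm{minrank}[D,q]=\min_{f\in F[D,q]}\operatorname{rank}(f)$, $\mathrm{minrank}[D]=\min_{q\ge 2}\mathrm{minrank}[D,q]$. The conjunctive network on $D$ is the Boolean map with $f_v(x)=\bigwedge_{u\in N^-(v)}x_u$ (empty conjunction equal to $1$), and $\mathrm{crank}[D]$ is its rank. *)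

(* Defs.v *)
From mathcomp Require Import all_boot.

Set Implicit Arguments.
Unset Strict Implicit.
Unset Printing Implicit Defensive.

Section Networks.

Variables (N : nat) (A : finType).

Definition state : finType := {ffun 'I_N -> A}.

Definition network : Type := state -> state.

(* [b] may equal [a] off [u] only; [f a v != f b v] then forces [a u != b u]. *)
Definition IG (f : network) : rel 'I_N := fun u v =>
  [exists a : state, exists b : state,
     [forall w : 'I_N, (w != u) ==> (a w == b w)] && (f a v != f b v)].

Definition rank (f : network) : nat := #|f @: [set: state]|.

End Networks.

Section MinRank.

Variable N : nat.

(* F[D, q], with <q> rendered by 'I_q. *)
Definition in_F (D : rel 'I_N) (q : nat) (f : network N 'I_q) : Prop :=
  IG f =2 D.

Definition is_min (S : nat -> Prop) (m : nat) : Prop :=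
  S m /\ (forall k, S k -> m <= k).

(* Minima are stated as attained lower bounds: [is_minrank_q D q m] reads
   minrank[D, q] = m and [is_minrank D m] reads minrank[D] = m. *)
Definition is_minrank_q (D : rel 'I_N) (q m : nat) : Prop :=
  is_min (fun k => exists2 f : network N 'I_q, in_F D f & rank f = k) m.

Definition is_minrank (D : rel 'I_N) (m : nat) : Prop :=
  is_min (fun k => exists2 q, 2 <= q & is_minrank_q D q k) m.

Definition conj_net (D : rel 'I_N) : network N bool := fun x =>
  [ffun v => \big[andb/true]_(u | D u v) x u].

Definition crank (D : rel 'I_N) : nat := rank (conj_net D).

End MinRank.

(* The vertex called 1 in [n+1] = {1, ..., n+1} is [ord0]. *)
Definition star_loops (n : nat) : rel 'I_n.+1 := fun u v =>
  (v != ord0) && ((u == ord0) || (u == v)).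

(* Main.v *)
(** In a network [f] on this digraph, [f_v] depends only on [x_1] and [x_v], and
    it does depend on [x_v].  So for every [v != 1] the image of [f] contains two
    points differing exactly in coordinate [v]; a set with such a pair for each of
    [n] coordinates has at least [n + 1] points, because erasing one of the
    coordinates merges two points and keeps the other pairs.

    For two letters, let [S] be the set of [v] for which [f_v(0, .)] is not
    constant.  The points with [x_1 = 0] have at least [2 ^ #|S|] images, and
    those with [x_1 = 1] at least [2 ^ (n - #|S|)], obtained by varying the
    coordinates outside [S].  On these coordinates the former images are constant,
    so at most one image is common.  Convexity of [2 ^ k] concludes.

    With [n] letters, reading [x_1] as a vertex [v] and letting only [f_v] react
    to its own coordinate gives [n + 1] images; with two letters, let [x_1] choose
    which half of the other coordinates is copied, erasing the rest. *)

Require Import Defs.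
From mathcomp Require Import all_boot.

Set Implicit Arguments.
Unset Strict Implicit.
Unset Printing Implicit Defensive.

(** * Dependence on in-neighbours, and sets with a pair in each direction *)

Section AgreeOff.

Variables (N : nat) (A : finType).

Definition agree_off (u : 'I_N) (a b : state N A) : bool :=
  [forall w : 'I_N, (w != u) ==> (a w == b w)].

Lemma agree_offP (u : 'I_N) (a b : state N A) :
  reflect (forall w, w != u -> a w = b w) (agree_off u a b).
Proof.
apply: (iffP forallP) => [h w wu|h w].
  by move/implyP: (h w) => /(_ wu) /eqP.
by apply/implyP => wu; rewrite h.
Qed.

Lemma IGP (f : network N A) (u v : 'I_N) :
  reflect (exists a b, agree_off u a b /\ f a v != f b v) (IG f u v).
Proof.
apply: (iffP existsP) => [[a /existsP [b /andP [ab fab]]]|[a [b [ab fab]]]].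
  by exists a, b.
by exists a; apply/existsP; exists b; apply/andP.
Qed.

Definition update (a : state N A) (u : 'I_N) (c : A) : state N A :=
  [ffun w => if w == u then c else a w].

Lemma agree_off_update (a : state N A) (u : 'I_N) (c : A) :
  agree_off u a (update a u c).
Proof. by apply/agree_offP => w /negPf wu; rewrite ffunE wu. Qed.

(** The coordinates where [a] and [b] differ are changed one at a time; none of them is an
    in-neighbour of [v], so no change affects coordinate [v] of the image. *)
Lemma eq_on_in_neighbours (f : network N A) (v : 'I_N) (a b : state N A) :
  (forall u, IG f u v -> a u = b u) -> f a v = f b v.
Proof.
have [k] := ubnP #|[set w | a w != b w]|.
elim: k a => // k IHk a lek eqab.
have [eq0|[u]] := set_0Vmem [set w | a w != b w].
  congr (f _ v); apply/ffunP => w.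
  by move/setP: eq0 => /(_ w); rewrite !inE => /negbFE /eqP.
rewrite inE => abu.
have -> : f a v = f (update a u (b u)) v.
  apply/eqP; apply: contraNT abu => fne; apply/eqP/eqab/IGP.
  by exists a, (update a u (b u)); split=> //; exact: agree_off_update.
apply: IHk => [|w /eqab abw]; last by rewrite ffunE; case: eqP => [->|].
apply: leq_trans (lek : _ <= k); apply: proper_card; apply/properP; split.
  by apply/subsetP => w; rewrite !inE ffunE; have [->|] := eqVneq w u; rewrite ?eqxx.
by exists u; rewrite !inE // ffunE !eqxx.
Qed.

(* Bondy's argument: collapse one coordinate of [V] at a time. *)
Lemma card_gt_directions (V : {set 'I_N}) (S : {set state N A}) :
  S != set0 ->
  (forall v, v \in V ->
     exists x y, [/\ x \in S, y \in S, agree_off v x y & x v != y v]) ->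
  #|V| < #|S|.
Proof.
have [k] := ubnP #|V|; elim: k V S => // k IHk V S leVk S0 dirV.
have [->|[v vV]] := set_0Vmem V; first by rewrite cards0 card_gt0.
have [x [y [xS yS xy xyv]]] := dirV v vV.
pose p z := update z v (x v).
have pxy : p x = p y.
  apply/ffunP => w; rewrite !ffunE; case: eqP => // /eqP wv.
  exact: (agree_offP _ _ _ xy).
have ltpS : #|p @: S| < #|S|.
  rewrite ltn_neqAle leq_imset_card andbT; apply: contra xyv => /imset_injP.
  by move/(_ x y xS yS pxy) => ->.
rewrite (cardsD1 v) vV add1n; apply: leq_trans ltpS.
rewrite ltnS; apply: IHk.
- by move: leVk; rewrite (cardsD1 v) vV.
- by apply/set0Pn; exists (p x); apply: imset_f.
move=> w; rewrite !inE => /andP [wv /dirV [a [b [aS bS /agree_offP ab abw]]]].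
exists (p a), (p b); split; try exact: imset_f; last by rewrite !ffunE (negPf wv).
by apply/agree_offP => t tw; rewrite !ffunE; case: eqP => // _; apply: ab.
Qed.

End AgreeOff.

(** * Lower bound [n + 1] over any alphabet *)

Section StarLowerBounds.

Variables (n : nat) (A : finType) (f : network n.+1 A).
Hypothesis IGf : IG f =2 @star_loops n.

Lemma star_local (v : 'I_n.+1) (a b : state n.+1 A) :
  a ord0 = b ord0 -> a v = b v -> f a v = f b v.
Proof.
move=> ab0 abv; apply: eq_on_in_neighbours => u.
by rewrite IGf => /andP [_ /orP [] /eqP ->].
Qed.

Lemma star_local0 (a b : state n.+1 A) : f a ord0 = f b ord0.
Proof. by apply: eq_on_in_neighbours => u; rewrite IGf. Qed.

Lemma star_loop (v : 'I_n.+1) :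
  v != ord0 -> exists a b, agree_off v a b /\ f a v != f b v.
Proof. by move=> v0; apply/IGP; rewrite IGf /star_loops v0 eqxx orbT. Qed.

Lemma star_rank_gt : 0 < n -> n < rank f.
Proof.
move=> n0; suff : #|[set~ (ord0 : 'I_n.+1)]| < rank f by rewrite cardsC1 card_ord.
apply: card_gt_directions => [|v].
  (* [A] might be empty, so a state is taken from the loop at [inord n], which is not [ord0] because
     [0 < n]. *)
  have [|a _] := @star_loop (inord n); last first.
    by apply/set0Pn; exists (f a); apply: imset_f.
  by rewrite -val_eqE /= inordK // -lt0n.
rewrite !inE => v0; have [a [b [/agree_offP ab fab]]] := star_loop v0.
exists (f a), (f b); split; rewrite ?imset_f //.
apply/agree_offP => w wv.
have [->|w0] := eqVneq w ord0; first exact: star_local0.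
by apply: star_local; apply: ab; rewrite // eq_sym.
Qed.

End StarLowerBounds.

(** * Lower bound over two letters *)

Lemma I2_neq (x y z : 'I_2) : x != y -> (z == x) || (z == y).
Proof. by case: x y z => [[|[]]] // ? [[|[]]] // ? [[|[]]]. Qed.

(** The symmetry between [k] and [m - k] allows [k <= m./2]. With [m./2 = k + d] and
    [2 ^ d = e + 1], what remains is [2 ^ k * e <= 2 ^ uphalf m * e]. *)
Lemma exp2_balanced (m k : nat) :
  k <= m -> 2 ^ uphalf m + 2 ^ m./2 <= 2 ^ k + 2 ^ (m - k).
Proof.
wlog lek : k / k <= m./2 => [hw km|km].
  have [|ltk] := leqP k m./2; first by move/hw; apply.
  have := hw (m - k); rewrite subKn // (addnC (2 ^ (m - k))); apply; last exact: leq_subr.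
  rewrite leq_subLR -{1}(odd_double_half m) -addnn addnA leq_add2r.
  by rewrite (leq_trans _ ltk) // -add1n leq_add2r leq_b1.
have hm : uphalf m + m./2 = m by rewrite uphalf_half -addnA addnn odd_double_half.
have -> : m - k = uphalf m + (m./2 - k) by rewrite addnBA // hm.
move: lek => /subnKC; move: (m./2 - k) => d eqd.
have leu : k + d <= uphalf m by rewrite eqd uphalf_half leq_addl.
rewrite -eqd !expnD addnC.
have h : 2 ^ k * 2 ^ d <= 2 ^ uphalf m by rewrite -expnD leq_exp2l.
have ku : 2 ^ k <= 2 ^ uphalf m.
  by rewrite leq_exp2l // (leq_trans (leq_addr d k)).
have : 0 < 2 ^ d by rewrite expn_gt0.
case: (2 ^ d) => // e _.
by rewrite !mulnS -addnA leq_add2l addnC leq_add2l leq_mul2r ku orbT.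
Qed.

Section StarBinaryLowerBound.

Variables (n : nat) (f : network n.+1 'I_2).
Hypothesis IGf : IG f =2 @star_loops n.

Definition sensitive (c : 'I_2) (v : 'I_n.+1) : bool :=
  [exists a : state n.+1 'I_2, exists b : state n.+1 'I_2,
     [&& a ord0 == c, agree_off v a b & f a v != f b v]].

Definition point (c : 'I_2) (T : {set 'I_n.+1}) : state n.+1 'I_2 :=
  [ffun v => if v == ord0 then c else if v \in T then ord_max else ord0].

(** With two letters, [x v] and [y v] are, in some order, the letters at [v] of the pair witnessing
    sensitivity; locality then carries the two distinct values over to [x] and [y]. *)
Lemma sensitive_neq (c : 'I_2) (v : 'I_n.+1) (x y : state n.+1 'I_2) :
  v != ord0 -> sensitive c v -> x ord0 = c -> y ord0 = c -> x v != y v ->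
  f x v != f y v.
Proof.
move=> v0 /existsP [a /existsP [b /and3P [/eqP a0 /agree_offP ab fab]]] x0 y0 xyv.
have b0 : b ord0 = c by rewrite -ab // eq_sym.
have loc := star_local IGf.
have [/orP [] /eqP av /orP [] /eqP bv] := (I2_neq (a v) xyv, I2_neq (b v) xyv).
- by rewrite (loc v a b) ?eqxx ?a0 ?b0 ?av ?bv // in fab.
- by rewrite -(loc v a x) -?(loc v b y) // ?a0 ?b0.
- by rewrite -(loc v b x) -?(loc v a y) // ?a0 ?b0 // eq_sym.
- by rewrite (loc v a b) ?eqxx ?a0 ?b0 ?av ?bv // in fab.
Qed.

(** Images differ at each coordinate of [S] where [T] and [U] differ. Equality is asked on [S] only,
    since for points common to the two image families nothing more is known at first. *)
Lemma point_determined (c : 'I_2) (S T U : {set 'I_n.+1}) :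
  ord0 \notin S -> {in S, forall v, sensitive c v} ->
  T \subset S -> U \subset S ->
  {in S, forall v, f (point c T) v = f (point c U) v} -> T = U.
Proof.
move=> S0 sensS TS US eqf; apply/setP => v; have [vS|vS] := boolP (v \in S).
  have v0 : v != ord0 by apply: contraNneq S0 => <-.
  apply/eqP; move/eqP: (eqf v vS); apply: contraTT => TU.
  apply: (@sensitive_neq c); rewrite ?sensS ?ffunE ?eqxx ?(negPf v0) //.
  by move: TU; do 2 case: (v \in _).
by rewrite (contraNF (subsetP TS v)) // (contraNF (subsetP US v)).
Qed.

Lemma card_sensitive_image (c : 'I_2) (S : {set 'I_n.+1}) :
  ord0 \notin S -> {in S, forall v, sensitive c v} ->
  #|[set f (point c T) | T in powerset S]| = 2 ^ #|S|.
Proof.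
move=> S0 sensS; rewrite card_in_imset ?card_powerset // => T U.
rewrite !powersetE => TS US eqf; apply: (point_determined S0 sensS) => // v _.
by rewrite eqf.
Qed.

Lemma star_binary_rank_ge : 2 ^ uphalf n + 2 ^ n./2 - 1 <= rank f.
Proof.
pose S := [set v : 'I_n.+1 | (v != ord0) && sensitive ord0 v].
pose S' := [set v : 'I_n.+1 | (v != ord0) && ~~ sensitive ord0 v].
have cardS : #|S| + #|S'| = n.
  rewrite -[RHS]/n.+1.-1 -[in RHS](card_ord n.+1) -(cardsC1 ord0).
  rewrite -(cardsID [set v | sensitive ord0 v] [set~ ord0]).
  by congr (_ + _); apply: eq_card => v; rewrite !inE // andbC.
have sensS : {in S, forall v, sensitive ord0 v} by move=> v; rewrite inE => /andP [].
(* The loop at [v] shows up for at least one of the two letters at [ord0]; on [S'] it can only be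
   [ord_max]. *)
have sensS' : {in S', forall v, sensitive ord_max v}.
  move=> v; rewrite inE => /andP [v0 nsens].
  have [a [b [ab fab]]] := star_loop IGf v0.
  apply/existsP; exists a; apply/existsP; exists b; rewrite ab fab !andbT.
  have /orP [/eqP a0|//] := @I2_neq ord0 ord_max (a ord0) isT.
  case/negP: nsens; apply/existsP; exists a; apply/existsP; exists b.
  by rewrite a0 ab fab eqxx.
have S0 : ord0 \notin S by rewrite inE eqxx.
have S'0 : ord0 \notin S' by rewrite inE eqxx.
pose X := [set f (point ord0 T) | T in powerset S].
pose Y := [set f (point ord_max T) | T in powerset S'].
(* Giving the first point the letter of the second at [v] cannot change the value there, as [v] is
   insensitive; locality does the rest. *)
have cst T U v : v \in S' -> f (point ord0 T) v = f (point ord0 U) v.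
  rewrite inE => /andP [v0 nsens]; apply/eqP; apply: contraNT nsens => fne.
  apply/existsP; exists (point ord0 T).
  apply/existsP; exists (update (point ord0 T) v (point ord0 U v)).
  rewrite agree_off_update ffunE !eqxx /=.
  rewrite (star_local IGf (a := update _ _ _) (b := point ord0 U)) //.
    by rewrite !ffunE eq_sym (negPf v0) eqxx.
  by rewrite ffunE eqxx.
have XY1 : #|X :&: Y| <= 1.
  apply/card_le1P => z; rewrite inE => /andP [zX]; case/imsetP: (zX) => T _ zT.
  case/imsetP => U; rewrite powersetE => US' zU y; rewrite !inE.
  apply/andP/eqP => [[/imsetP [T' _ yT'] /imsetP [U']]|->].
    rewrite powersetE => US'' yU'; rewrite yU' zU; congr (f (point _ _)).
    apply: (point_determined S'0 sensS') => // v vS'.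
    by rewrite -yU' -zU zT yT'; apply: cst.
  split=> //.
  by rewrite zU; apply: imset_f; rewrite powersetE.
have XYf : X :|: Y \subset f @: [set: state n.+1 'I_2].
  by rewrite subUset; apply/andP; split; apply/subsetP => z /imsetP [T _ ->];
     apply: imset_f.
apply: leq_trans (subset_leq_card XYf).
(* The [- 1] absorbs the single possible common image. *)
rewrite leq_subLR; apply: leq_trans (leq_add XY1 (leqnn _)).
rewrite (addnC #|X :&: Y|) cardsUI !card_sensitive_image //.
move: #|S| #|S'| cardS => k k' <-.
by rewrite -[in 2 ^ k'](addKn k k') exp2_balanced ?leq_addr.
Qed.

End StarBinaryLowerBound.

(** * Networks attaining the bounds *)

Section StarNetworks.

Variables (n : nat) (A : finType) (c : A) (g : 'I_n.+1 -> A -> A -> A).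

Definition star_net : network n.+1 A := fun x =>
  [ffun v => if v == ord0 then c else g v (x ord0) (x v)].

(** The hypotheses yield the arcs from [ord0] and the loops; the form of [star_net] excludes all
    other arcs. *)
Lemma IG_star_net :
  (forall v, v != ord0 -> exists a b s, g v a s != g v b s) ->
  (forall v, v != ord0 -> exists a s t, g v a s != g v a t) ->
  IG star_net =2 @star_loops n.
Proof.
move=> dep0 depv u v; rewrite /star_loops.
have [->|v0] /= := eqVneq v ord0.
  by apply/IGP => -[a [b [_]]]; rewrite !ffunE !eqxx.
have [->|u0] /= := eqVneq u ord0.
  have [a [b [s ne]]] := dep0 v v0; apply/IGP.
  exists [ffun w => if w == ord0 then a else s].
  exists [ffun w => if w == ord0 then b else s].
  rewrite !ffunE eqxx (negPf v0); split=> //.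
  by apply/agree_offP => w /negPf w0; rewrite !ffunE w0.
have [->|uv] := eqVneq u v.
  have [a [s [t ne]]] := depv v v0; apply/IGP.
  exists [ffun w => if w == ord0 then a else s].
  exists [ffun w => if w == ord0 then a else if w == v then t else s].
  rewrite !ffunE !eqxx (negPf v0); split=> //.
  by apply/agree_offP => w /negPf wv; rewrite !ffunE wv.
apply/IGP => -[a [b [/agree_offP ab]]].
by rewrite !ffunE (negPf v0) !ab ?eqxx // eq_sym.
Qed.

End StarNetworks.

Lemma star_net_rank_n (n : nat) : 1 < n ->
  exists2 f : network n.+1 'I_n, in_F (@star_loops n) f & rank f <= n.+1.
Proof.
case: n => [|[|m]] // _; set n := m.+2.
pose g (v : 'I_n.+1) (a s : 'I_n) : 'I_n :=
  if (lift ord0 a == v) && (s == ord0) then ord_max else ord0.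
exists (star_net ord0 g).
  apply: IG_star_net => v; rewrite eq_sym => /unlift_some [a eqv _].
    (* The second letter only has to differ from [a], the letter naming [v]. *)
    exists a, (if a == ord0 then ord_max else ord0), ord0.
    rewrite /g eqv !(inj_eq lift_inj) !eqxx andbT.
    by case: (eqVneq a ord0) => [->|a0]; rewrite //= (eq_sym ord0) (negPf a0).
  by exists a, ord0, ord_max; rewrite /g eqv !eqxx.
(* The [n + 1] candidate images: all [ord0] for [u = ord0], otherwise a single [ord_max] at [u]. *)
pose h (u : 'I_n.+1) : state n.+1 'I_n :=
  [ffun v => if (v == u) && (u != ord0) then ord_max else ord0].
rewrite -[leqRHS](card_ord n.+1) -cardsT.
apply: leq_trans (leq_imset_card h _); apply: subset_leq_card.
apply/subsetP => _ /imsetP [x _ ->]; apply/imsetP.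
pose a := x ord0.
exists (if x (lift ord0 a) == ord0 then lift ord0 a else ord0) => //.
apply/ffunP => v; rewrite !ffunE -/a /g.
have [->|v0] := eqVneq v ord0.
  by case: (x (lift ord0 a) == ord0); rewrite ?eqxx ?andbF // (negPf (neq_lift _ _)).
have [<-|av] := eqVneq (lift ord0 a) v.
  by case: (x (lift ord0 a) == ord0); rewrite ?eqxx ?andbF // eq_sym neq_lift.
by case: (x (lift ord0 a) == ord0); rewrite ?eqxx ?andbF // (eq_sym v) (negPf av).
Qed.

Lemma star_net_binary_rank (n : nat) :
  exists2 f : network n.+1 'I_2,
    in_F (@star_loops n) f & rank f <= 2 ^ uphalf n + 2 ^ n./2 - 1.
Proof.
have le2n : n./2 <= n by rewrite -{2}(odd_double_half n) -addnn addnA leq_addl.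
pose K := [set lift ord0 (widen_ord le2n i) | i : 'I_n./2].
pose K' := [set~ ord0] :\: K.
pose g (v : 'I_n.+1) (a s : 'I_2) : 'I_2 :=
  if (a == ord0) == (v \in K) then s else ord0.
have K0 : ord0 \notin K.
  by apply/imsetP => -[i _ /eqP]; rewrite (negPf (neq_lift _ _)).
have inK' v : (v \in K') = (v \notin K) && (v != ord0) by rewrite !inE.
have cardK : #|K| = n./2.
  rewrite card_imset ?card_ord //.
  by apply: inj_comp lift_inj _ => i j /(congr1 val) /= /val_inj.
have cardK' : #|K'| = uphalf n.
  rewrite cardsD (setIidPr _) ?cardK ?cardsC1 ?card_ord /=.
    by rewrite -{1}(odd_double_half n) -addnn addnA addnK uphalf_half.
  by apply/subsetP => v vK; rewrite !inE; apply: contraNneq K0 => <-.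
exists (star_net ord0 g).
  apply: IG_star_net => v v0.
    by exists ord0, ord_max, ord_max; rewrite /g; case: (v \in K).
  (* This is the letter at [ord0] for which [v] is copied. *)
  exists (if v \in K then ord0 else ord_max), ord0, ord_max.
  by rewrite /g; case: (v \in K).
pose h (T : {set 'I_n.+1}) : state n.+1 'I_2 :=
  [ffun v => if v \in T then ord_max else ord0].
pose X := h @: powerset K; pose Y := h @: powerset K'.
have fXY : star_net ord0 g @: [set: state n.+1 'I_2] \subset X :|: Y.
  apply/subsetP => _ /imsetP [x _ ->].
  pose L := if x ord0 == ord0 then K else K'.
  have xL : star_net ord0 g x = h [set v in L | x v == ord_max].
    apply/ffunP => v; rewrite !ffunE /g inE /L.
    have [->|v0] := eqVneq v ord0.
      by case: (x ord0 == ord0); rewrite ?inK' ?eqxx ?andbF // (negPf K0).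
    have /orP xv := @I2_neq ord0 ord_max (x v) isT.
    by case: (x ord0 == ord0); rewrite ?inK' ?v0 ?andbT; case: (v \in K) => //=;
       case: xv => /eqP ->; rewrite ?eqxx.
  by rewrite xL inE /L; case: ifP => _; apply/orP; [left|right];
     apply: imset_f; rewrite powersetE; apply/subsetP => v; rewrite inE => /andP [].
apply: leq_trans (subset_leq_card fXY) _.
(* The state with all letters [ord0] belongs to both families, which saves one image. *)
have XY : 0 < #|X :&: Y|.
  by apply/card_gt0P; exists (h set0); rewrite inE !imset_f // powersetE sub0set.
rewrite cardsU leq_sub // addnC -cardK -cardK' -!card_powerset.
by rewrite leq_add // leq_imset_card.
Qed.

(** Coordinate [ord0] is an empty conjunction, hence true. The others are all false or copied
    according to [x ord0], so every pattern on them occurs; each [h T] is even a fixed point. *)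
Lemma crank_star (n : nat) : crank (@star_loops n) = 2 ^ n.
Proof.
pose h (T : {set 'I_n.+1}) : state n.+1 bool :=
  [ffun v => (v == ord0) || (v \in T)].
have conjE (x : state n.+1 bool) v :
    conj_net (@star_loops n) x v = (v == ord0) || (x ord0 && x v).
  rewrite ffunE big_all_cond; apply/allP/orP => [hx|].
    have [->|v0] := eqVneq v ord0; [by left | right].
    have hx' u := hx u (mem_index_enum u).
    by rewrite (implyP (hx' ord0)) ?(implyP (hx' v)) /star_loops ?v0 ?eqxx ?orbT.
  move=> hv u _; apply/implyP => /andP [v0 uv]; case: hv => [|/andP [x0 xv]].
    by rewrite (negPf v0).
  by case/orP: uv => /eqP ->.
have -> : crank (@star_loops n) = #|h @: powerset [set~ ord0]|.
  congr #|pred_of_set _|; apply/setP => y; apply/imsetP/imsetP => [[x _ ->]|[T _ ->]].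
    exists [set v | (v != ord0) && (x ord0 && x v)].
      by rewrite powersetE; apply/subsetP => v; rewrite !inE => /andP [].
    by apply/ffunP => v; rewrite conjE !ffunE inE; case: eqP.
  exists (h T) => //; apply/ffunP => v; rewrite conjE !ffunE eqxx /=.
  by case: eqP.
rewrite card_in_imset ?card_powerset ?cardsC1 ?card_ord // => T U.
rewrite !powersetE => /subsetP T0 /subsetP U0 /ffunP eqh; apply/setP => v.
have [->|v0] := eqVneq v ord0.
  by rewrite (contraFF (T0 ord0)) ?(contraFF (U0 ord0)) // !inE eqxx.
by move: (eqh v); rewrite !ffunE (negPf v0).
Qed.

Theorem theorem3p10 (n : nat) (hn : 3 <= n) (hodd : odd n) :
  [/\ crank (@star_loops n) = 2 ^ n,
      is_minrank_q (@star_loops n) 2 (2 ^ uphalf n + 2 ^ n./2 - 1),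
      is_minrank_q (@star_loops n) n n.+1
    & is_minrank (@star_loops n) n.+1].
Proof.
have n0 : 0 < n by apply: leq_trans hn.
have minn : is_minrank_q (@star_loops n) n n.+1.
  split=> [|_ [f fF <-]]; last exact: star_rank_gt.
  have [f fF lef] := star_net_rank_n (ltnW hn).
  by exists f => //; apply/eqP; rewrite eqn_leq lef star_rank_gt.
split=> //; first exact: crank_star.
  split=> [|_ [f fF <-]]; last exact: star_binary_rank_ge.
  have [f fF lef] := star_net_binary_rank n.
  by exists f => //; apply/eqP; rewrite eqn_leq lef star_binary_rank_ge.
split; first by exists n => //; exact: ltnW.
(* The bound [n < rank f] holds whatever the alphabet, hence for every [q]. *)
by move=> k [q _ [[f fF <-] _]]; exact: star_rank_gt.
Qed.
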